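(* Let $p$ be an odd prime, let $g$ be a (fixed) primitive root modulo $p^2$ with $q_p(g)=\delta$ (so $1\le\delta<p$), and let $\beta\in\overline{\mathbb{F}}_2$ be a primitive $p^2$-th root of unity. Let $\lambda$ be the smallest positive integer satisfying $2^\lambda\equiv 1\pmod p$. Let $(f_u)$ be the Legendre-Fermat quotient sequence defined, for $u\ge 0$, by $f_u=0$ if $\left(\frac{q_p(u)}{p}\right)=1$ or $q_p(u)=0$, and $f_u=1$ otherwise, where $\left(\frac{\cdot}{p}\right)$ is the Legendre symbol. Let $N$ be the set of quadratic non-residues modulo $p$ (in $\{1,\dots,p-1\}$), and for $0\le j<p$ put $$\eta'_j=\sum_{l\in N}D_{l+j\delta}(\beta).$$ If $2^{p-1}\not\equiv 1\pmod{p^2}$, then for all $u\ge 0$ $$f_u=\frac{p-1}{2}\sum_{k=0}^{\frac{p-1}{\lambda}-1}\mathrm{Tr}^{\lambda}_1\left(\beta^{upg^k}\right)+\sum_{j=0}^{p-1}\eta'_j\sum_{k=0}^{\frac{p-1}{\lambda}-1}\mathrm{Tr}^{\lambda p}_p\left(\beta^{ug^{kp+j}}\right),$$ and otherwise (that is, if $2^{p-1}\equiv 1\pmod{p^2}$), for all $u\ge 0$ $$f_u=\frac{p-1}{2}\sum_{k=0}^{\frac{p-1}{\lambda}-1}\mathrm{Tr}^{\lambda}_1\left(\beta^{upg^k}\right)+\sum_{j=0}^{p-1}\eta'_j\sum_{k=0}^{\frac{p-1}{\lambda}-1}\mathrm{Tr}^{\lambda}_1\left(\beta^{ug^{kp+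j}}\right).$$
   Context: Fermat quotient: for an odd prime $p$ and an integer $u$ with $\gcd(u,p)=1$, $q_p(u)$ is the unique integer with $q_p(u)\equiv\frac{u^{p-1}-1}{p}\pmod p$ and $0\le q_p(u)\le p-1$; moreover $q_p(kp)=0$ for all $k\in\mathbb{Z}$. $\mathbb{F}_2=\{0,1\}$ is the binary field and $\overline{\mathbb{F}}_2$ its algebraic closure. All identities for sequence values are in $\overline{\mathbb{F}}_2$, with $f_u\in\mathbb{F}_2\subset\overline{\mathbb{F}}_2$ and integers such as $\frac{p-1}{2}$ read modulo 2. For $l=0,1,\ldots,p-1$ let $D_l=\{u:0\le u<p^2,\ \gcd(u,p)=1,\ q_p(u)=l\}$, with the subscript of $D$ taken modulo $p$ (so $D_{l+p}=D_l$), and let $D_l(x)=\sum_{u\in D_l}x^u\in\mathbb{F}_2[x]$. For $k\mid n$, the trace function from $\mathbb{F}_{2^n}$ to $\mathbb{F}_{2^k}$ is $\mathrm{Tr}^n_k(x)=x+x^{2^k}+x^{2^{2k}}+\cdots+x^{2^{(n/k-1)k}}$. *)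

(* Defs.v *)
(* Mathematical Components (ssreflect style). *)
From HB Require Import structures.
From mathcomp Require Import all_boot all_order all_algebra.

Set Implicit Arguments.
Unset Strict Implicit.
Unset Printing Implicit Defensive.

Import GRing.Theory.
Local Open Scope ring_scope.

(* The subtraction is not truncated, as u ^ p.-1 > 0 when u is coprime to p;
   the division by p is then exact by Fermat's little theorem. *)
Definition fermat_quotient (p u : nat) : nat :=
  (if coprime u p then ((u ^ p.-1 - 1) %/ p) %% p else 0)%N.

Definition legendre (p a : nat) : int :=
  if (p %| a)%N then 0
  else if [exists x : 'I_p, (x ^ 2 == a %[mod p])%N] then 1 else -1.

(* The multiplicative order of g modulo n is the totient of n.  Only meaningful
   for n > 1, because 'Z_n is the ring of integers modulo maxn n 2. *)
Definition primitive_root_mod (n g : nat) : bool :=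
  (totient n).-primitive_root (g%:R : 'Z_n).

(* The class D_l, with its subscript l read modulo p. *)
Definition fq_class (p l : nat) : {set 'I_(p ^ 2)} :=
  [set u : 'I_(p ^ 2) | coprime u p & fermat_quotient p u == (l %% p)%N].

Definition fq_class_poly (p l : nat) : {poly 'F_2} :=
  \sum_(u in fq_class p l) 'X^u.

Definition legendre_fermat (p u : nat) : 'F_2 :=
  if (legendre p (fermat_quotient p u) == 1) || (fermat_quotient p u == 0%N)
  then 0 else 1.

(* Quadratic non-residues; the element 0 of 'I_p has symbol 0. *)
Definition nonresidues (p : nat) : {set 'I_p} :=
  [set l : 'I_p | legendre p l == -1].

(* For k dividing n, the restriction of this function to the subfield of
   order 2 ^ n of a field L of characteristic 2 is the trace from that subfield
   to the subfield of order 2 ^ k. *)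
Definition trace2 (L : fieldType) (n k : nat) (x : L) : L :=
  \sum_(i < n %/ k) x ^+ (2 ^ (i * k)).

Definition eta' (L : fieldType) (iota : {rmorphism 'F_2 -> L}) (beta : L)
    (p delta j : nat) : L :=
  \sum_(l in nonresidues p)
     (map_poly iota (fq_class_poly p (l + j * delta))).[beta].

(* Main.v *)
(* The right-hand side is the inverse discrete Fourier transform of the
   sequence modulo p^2.  As q_p is a morphism from the units modulo p^2 to Z/p,
   the transform at a unit x with q_p(x) = j * delta is eta'_j, and at a nonzero
   multiple of p it is (p - 1)/2.  Inverting it comes down to Ramanujan sums over
   the units modulo p^2.  The traces appear because the p-th powers modulo p^2
   form a cyclic group of order p - 1, generated by g^p, which is cut into cosets
   of the subgroup of order lambda generated by 2^p, or by 2 itself when 2 is a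
   p-th power, that is, when 2^(p-1) = 1 modulo p^2. *)
Require Import Defs.
From HB Require Import structures.
From mathcomp Require Import all_boot all_order all_algebra.
From mathcomp Require Import cyclic.
From mathcomp Require Import zify.

Import GRing.Theory.
Local Open Scope ring_scope.

(** * Reindexing of finite sums, cosets and geometric sums *)

Lemma imset_inj_card (A B : finType) (P : {set B}) (f : A -> B) :
  injective f -> (forall a, f a \in P) -> (#|P| <= #|A|)%N ->
  [set f a | a : A] = P.
Proof.
move=> f_inj fP cardP; apply/eqP; rewrite eqEcard card_imset // cardP andbT.
by apply/subsetP => _ /imsetP[a _ ->].
Qed.

Lemma sum_inj_card (V : nmodType) (A B : finType) (P : {set B}) (f : A -> B)
    (F : B -> V) :
  injective f -> (forall a, f a \in P) -> (#|P| <= #|A|)%N ->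
  \sum_a F (f a) = \sum_(b in P) F b.
Proof.
move=> f_inj fP cardP; rewrite -(@imset_inj_card _ _ P f) // big_imset //=.
by move=> a b _ _ /f_inj.
Qed.

(** An injection of the residues modulo [n] into themselves is a permutation. The periodicity of [F]
    lets [s] take values beyond [n]. *)
Lemma sum_reindex_mod (V : nmodType) (n : nat) (F : nat -> V) (s : nat -> nat) :
  (0 < n)%N -> (forall a, F (a %% n)%N = F a) ->
  (forall a b, (s a = s b %[mod n] -> a = b %[mod n])%N) ->
  \sum_(i < n) F (s i) = \sum_(i < n) F i.
Proof.
move=> n_gt0 Fmod s_inj.
pose f (i : 'I_n) := Ordinal (ltn_pmod (s i) n_gt0).
have f_inj : injective f.
  move=> i j /(congr1 val) /= /s_inj; rewrite !modn_small // => ij.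
  exact: val_inj.
rewrite [RHS](reindex f) /=; last exact/onW_bij/injF_bij.
by apply: eq_bigr => i _; rewrite Fmod.
Qed.

(* In the additive group Z/n, the multiples of [m] form the subgroup of order
   [d], whose cosets are represented by [0, ..., n/d - 1]. *)
Lemma sum_subgroup_cosets (V : nmodType) (n q d m : nat) (G : nat -> V) :
  n = (q * d)%N -> (0 < n)%N -> (forall a, G (a %% n)%N = G a) ->
  (n %| m * d)%N -> (forall i, n %| m * i -> d %| i)%N ->
  \sum_(0 <= k < q) \sum_(i < d) G (k + m * i)%N = \sum_(0 <= e < n) G e.
Proof.
move=> n_qd n_gt0 Gmod n_md m_ord.
rewrite !big_mkord pair_bigA /=.
pose f (t : 'I_q * 'I_d) := Ordinal (ltn_pmod (t.1 + m * t.2) n_gt0).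
suff f_inj : injective f.
  rewrite [RHS](reindex f) /=.
    by apply: eq_bigr => t _; rewrite Gmod.
  by apply/onW_bij/inj_card_bij; rewrite // card_prod !card_ord n_qd.
move=> [k i] [k' i'] /(congr1 val) /= E.
  have d_gt0 : (0 < d)%N by move: (n_gt0); rewrite n_qd muln_gt0 => /andP[].
  have kd_lt (a : 'I_q) : (a * d < n)%N by rewrite n_qd ltn_pmul2r.
  have kk' : k = k'.
    (* Multiplying by [d] kills [m * i] modulo [n] and leaves [k * d], which is below [n] and so
       determines [k]. *)
    have: ((k + m * i) * d = (k' + m * i') * d %[mod n])%N.
      by rewrite -modnMml E modnMml.
    rewrite !mulnDl -![(m * _ * d)%N]mulnAC.
    rewrite -(modnDmr (k * d)) -(modnDmr (k' * d)) !(eqP (dvdn_mulr _ n_md)).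
    rewrite !addn0 !modn_small //.
    by move/eqP; rewrite eqn_pmul2r // => /eqP /val_inj.
  rewrite -{k'}kk' in E *; congr pair; apply: val_inj => /=.
  move/eqP: E; rewrite eqn_modDl.
  wlog le_ii' : i i' / (i <= i')%N.
    move=> W; case: (leqP i i') => [|/ltnW] h; first exact: W.
    by rewrite eq_sym => /(W _ _ h).
  rewrite eq_sym eqn_mod_dvd ?leq_mul2l ?le_ii' ?orbT // -mulnBr => /m_ord.
  have lt : (i' - i < d)%N by apply: leq_ltn_trans (ltn_ord i'); rewrite leq_subr.
  rewrite /dvdn modn_small // subn_eq0 => h.
  by apply/eqP; rewrite eqn_leq le_ii'.
Qed.

Lemma sum_geometric_root (L : fieldType) (n : nat) (z : L) :
  z ^+ n = 1 -> \sum_(i < n) z ^+ i = n%:R * (z == 1)%:R.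
Proof.
move=> zn1; case: eqP => [-> | /eqP z_neq1].
  rewrite mulr1 (eq_bigr (fun=> 1)); first by rewrite sumr_const card_ord.
  by move=> i _; rewrite expr1n.
apply/eqP; rewrite mulr0 -(mulrI_eq0 _ (mulfI (_ : z - 1 != 0))) ?subr_eq0 //.
by rewrite -subrX1 zn1 subrr.
Qed.

(** * Fermat quotients modulo [p ^ 2] *)

Lemma fermat_little (p u : nat) :
  prime p -> coprime u p -> (u ^ p.-1 = 1 %[mod p])%N.
Proof.
move=> p_pr cop; have /Euler_exp_totient := cop.
by rewrite -[p in totient p]expn1 totient_pfactor // expn0 muln1.
Qed.

Lemma fermat_quotient_lt (p u : nat) : prime p -> (fermat_quotient p u < p)%N.
Proof.
by move=> /prime_gt0 p_gt0; rewrite /fermat_quotient; case: ifP; rewrite ?ltn_mod.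
Qed.

(** As the quotient is below [p], this congruence determines it, so questions about it become
    questions about [u ^ p.-1] modulo [p ^ 2]. *)
Lemma fermat_quotient_expn (p u : nat) : prime p -> coprime u p ->
  (u ^ p.-1 = 1 + p * fermat_quotient p u %[mod p ^ 2])%N.
Proof.
move=> p_pr cop; rewrite /fermat_quotient cop muln_modr -[(p * p)%N]/(p ^ 2)%N.
have u_gt0 : (0 < u ^ p.-1)%N.
  rewrite expn_gt0; case: u cop => // /eqP; rewrite gcd0n => p1.
  by rewrite p1 in p_pr.
have p_dvd : (p %| u ^ p.-1 - 1)%N.
  by rewrite -eqn_mod_dvd //; apply/eqP/fermat_little.
by rewrite mulnC divnK // modnDmr subnKC.
Qed.

Lemma eqn_mod1Mp (p a b : nat) : (0 < p)%N ->
  (1 + p * a == 1 + p * b %[mod p ^ 2])%N = (a == b %[mod p])%N.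
Proof.
move=> p_gt0; rewrite eqn_modDl -[(p ^ 2)%N]/(p * p)%N -!muln_modr.
by rewrite eqn_pmul2l.
Qed.

Lemma fermat_quotient_eq (p u v : nat) : prime p -> coprime u p -> coprime v p ->
  (fermat_quotient p u == fermat_quotient p v) =
  (u ^ p.-1 == v ^ p.-1 %[mod p ^ 2])%N.
Proof.
move=> p_pr cu cv; rewrite !fermat_quotient_expn // eqn_mod1Mp ?prime_gt0 //.
by rewrite !modn_small // fermat_quotient_lt.
Qed.

Lemma coprime_modp2 (p u : nat) : coprime (u %% p ^ 2) p = coprime u p.
Proof. by rewrite -[LHS]coprime_modl modn_dvdm ?coprime_modl // dvdn_exp. Qed.

Lemma fermat_quotient_mod (p u : nat) : prime p ->
  fermat_quotient p (u %% p ^ 2) = fermat_quotient p u.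
Proof.
move=> p_pr; case: (boolP (coprime u p)) => cu; last first.
  by rewrite /fermat_quotient coprime_modp2 (negPf cu).
by apply/eqP; rewrite fermat_quotient_eq ?coprime_modp2 // modnXm.
Qed.

(** The quotient behaves like a logarithm because (1 + p a)(1 + p b) = 1 + p (a + b) modulo p^2. *)
Lemma fermat_quotientM (p u v : nat) : prime p -> coprime u p -> coprime v p ->
  fermat_quotient p (u * v) = ((fermat_quotient p u + fermat_quotient p v) %% p)%N.
Proof.
move=> p_pr cu cv; have cuv : coprime (u * v) p by rewrite coprimeMl cu.
rewrite -[LHS](modn_small (fermat_quotient_lt p (u * v) p_pr)).
apply/eqP; rewrite -eqn_mod1Mp ?prime_gt0 // -fermat_quotient_expn // expnMn.
rewrite -modnMm !fermat_quotient_expn // modnMm.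
set a := fermat_quotient p u; set b := fermat_quotient p v.
have -> : ((1 + p * a) * (1 + p * b) = a * b * p ^ 2 + (1 + p * (a + b)))%N by lia.
by rewrite modnMDl.
Qed.

(** The difference of the p-th powers is the difference of the bases times a sum of p terms, all
    equal to x^(p-1) modulo p; hence both factors are multiples of p. *)
Lemma expn_p_mod (p x y : nat) :
  (x = y %[mod p] -> x ^ p = y ^ p %[mod p ^ 2])%N.
Proof.
have [-> // | p_gt0] := posnP p.
wlog le_xy : x y / (x <= y)%N.
  move=> W; case: (leqP x y) => [|/ltnW] h E; first exact: W.
  by apply/esym/W.
move=> E; apply/eqP; rewrite eq_sym eqn_mod_dvd ?leq_exp2r //.
rewrite subn_exp -[(p ^ 2)%N]/(p * p)%N dvdn_mul //.
  by rewrite -eqn_mod_dvd //; apply/eqP.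
rewrite /dvdn -modn_summ (eq_bigr (fun=> x ^ p.-1 %% p)%N) => [|i _].
  by rewrite modn_summ sum_nat_const card_ord modnMr.
rewrite -modnMml -modnXm -E modnXm modnMml -expnD subnK //.
by rewrite -ltnS; case: (p) i => // [[]].
Qed.

Lemma mulnI_mod (n c a b : nat) : coprime n c ->
  (c * a = c * b %[mod n] -> a = b %[mod n])%N.
Proof.
move=> cop_c; wlog le_ab : a b / (a <= b)%N.
  move=> W; case: (leqP a b) => [|/ltnW] h; first exact: W.
  by move/esym/(W _ _ h).
move/eqP; rewrite eq_sym eqn_mod_dvd ?leq_mul2l ?le_ab ?orbT // -mulnBr.
by rewrite Gauss_dvdr // -eqn_mod_dvd // eq_sym => /eqP.
Qed.

(* A residue class modulo [p^2] is determined by its class modulo [p] and its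
   Fermat quotient, which fix [x^p] and [x^(p-1)] modulo [p^2]. *)
Lemma fermat_quotient_inj (p x y : nat) : prime p -> coprime x p ->
  (x = y %[mod p])%N -> fermat_quotient p x = fermat_quotient p y ->
  (x = y %[mod p ^ 2])%N.
Proof.
move=> p_pr cx Exy Eq.
have cy : coprime y p by rewrite -coprime_modl -Exy coprime_modl.
move/eqP: Eq; rewrite fermat_quotient_eq // => /eqP Eq.
have := expn_p_mod _ _ _ Exy.
have xpE z : (z ^ p = z ^ p.-1 * z)%N by rewrite -expnSr prednK ?prime_gt0.
rewrite !xpE -[RHS]modnMml -Eq modnMml.
have : coprime (p ^ 2) (x ^ p.-1) by rewrite coprime_sym coprimeXl ?coprimeXr.
by move=> cop_c /(mulnI_mod _ _ _ _ cop_c).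
Qed.

Lemma sum_residue_class (V : nmodType) (p u : nat) (G : nat -> V) : (0 < p)%N ->
  \sum_(w < p ^ 2 | w == u %[mod p]) G w = \sum_(k < p) G (u %% p + p * k)%N.
Proof.
move=> p_gt0.
have f_lt (k : 'I_p) : (u %% p + p * k < p ^ 2)%N.
  have := ltn_pmod u p_gt0; have := ltn_ord k; nia.
have h_lt (w : 'I_(p ^ 2)) : (w %/ p < p)%N by rewrite ltn_divLR.
rewrite (reindex_onto (fun k => Ordinal (f_lt k)) (fun w => Ordinal (h_lt w))).
  apply: eq_bigl => k; rewrite -val_eqE /= addnC mulnC modnMDl modn_mod eqxx /=.
  by rewrite divnMDl // divn_small ?ltn_pmod // addn0 eqxx.
move=> w /eqP E; apply: val_inj => /=.
by rewrite -E addnC mulnC -divn_eq.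
Qed.

(** By [fermat_quotient_inj] the p elements of the class have distinct quotients, all below p, so
    each value occurs exactly once. *)
Lemma sum_fermat_quotient (V : nmodType) (p u : nat) (G : nat -> V) :
  prime p -> coprime u p ->
  \sum_(w < p ^ 2 | w == u %[mod p]) G (fermat_quotient p w) = \sum_(l < p) G l.
Proof.
move=> p_pr cu; have p_gt0 := prime_gt0 p_pr.
rewrite (sum_residue_class V p u (fun w => G (fermat_quotient p w))) //.
have f_lt (k : 'I_p) := fermat_quotient_lt p (u %% p + p * k) p_pr.
rewrite [RHS](reindex (fun k => Ordinal (f_lt k))) //=.
apply/onW_bij/injF_bij => k k' /(congr1 val) /= /fermat_quotient_inj E.
have {E} : (u %% p + p * k = u %% p + p * k' %[mod p ^ 2])%N.
  apply: E => //; last by rewrite ![(p * _)%N]mulnC ![(u %% p + _)%N]addnC !modnMDl.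
  by rewrite -coprime_modl mulnC addnC modnMDl modn_mod coprime_modl.
move/eqP; rewrite eqn_modDl -[(p ^ 2)%N]/(p * p)%N -!muln_modr.
by rewrite eqn_pmul2l ?prime_gt0 // !modn_small // => /eqP/val_inj.
Qed.

(** * Counting quadratic non-residues *)

Lemma card_nonresidues (p : nat) : prime p -> odd p ->
  #|nonresidues p| = ((p - 1) %/ 2)%N.
Proof.
move=> p_pr p_odd; have p_gt0 := prime_gt0 p_pr.
set h := ((p - 1) %/ 2)%N; have p_h : p = (2 * h + 1)%N.
  by rewrite /h; lia.
(* As [a] starts at 0, these are the squares of 1, ..., h; since x and p - x have the same square,
   they exhaust the nonzero squares. *)
pose s (a : 'I_h) := Ordinal (ltn_pmod (a.+1 ^ 2) p_gt0).
have s_inj : injective s.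
  move=> a b /(congr1 val) /= /eqP.
  wlog le_ab : a b / (a <= b)%N.
    move=> W; case: (leqP a b) => [|/ltnW] le; first exact: W.
    by rewrite eq_sym => /(W _ _ le).
  (* The difference of squares is (b - a)(a + b + 2) with 2 <= a + b + 2 <= p - 1, so p can only
     divide b - a, which forces a = b. *)
  rewrite eq_sym eqn_mod_dvd ?leq_exp2r // subn_sqr Euclid_dvdM // subSS.
  have := ltn_ord a; have := ltn_ord b => lt_a lt_b /orP[|] /dvdnP[[|k]];
    rewrite ?mulSn => E; [by apply: val_inj => /=; lia | lia ..].
have imS : [set s a | a : 'I_h] =
    [set l : 'I_p | ~~ (p %| l)%N & [exists x : 'I_p, (x ^ 2 == l %[mod p])%N]].
  apply/setP => l; rewrite inE; apply/imsetP/idP.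
    case=> a _ ->; have lt_a := ltn_ord a; rewrite /= /dvdn modn_mod.
    rewrite -/(dvdn _ _) Euclid_dvdX // andbT gtnNdvd //=; last by lia.
    have a_lt : (a.+1 < p)%N by lia.
    by apply/existsP; exists (Ordinal a_lt).
  case/andP=> p_l /existsP[x /eqP E].
  have x_gt0 : (0 < x)%N.
    case: (posnP x) => // x0; case/negP: p_l.
    by rewrite /dvdn -E x0 mod0n.
  have [le_xh | lt_hx] := leqP x h.
    have lt : (x.-1 < h)%N by lia.
    exists (Ordinal lt) => //; apply: val_inj => /=.
    by rewrite prednK // E modn_small.
  (* A root above [h] is replaced by its negative [p - x], which is at most [h]. *)
  have := ltn_ord x => lt_xp.
  have lt : ((p - x).-1 < h)%N by lia.
  exists (Ordinal lt) => //; apply: val_inj => /=.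
  rewrite prednK ?subn_gt0 // -[LHS](modn_small (ltn_ord l)) -E.
  have [y Ey] : exists y : nat, p = (x + y)%N by exists (p - x)%N; lia.
  have -> : (p - x = y)%N by lia.
  (* With p = x + y, one has 2 y p + x^2 = p p + y^2. *)
  rewrite -(modnMDl (2 * y) (x ^ 2)) -(modnMDl p (y ^ 2)).
  by congr (_ %% _)%N; move: (val x) Ey => z ->; lia.
pose o := Ordinal p_gt0.
have -> : nonresidues p = ~: (o |: [set s a | a : 'I_h]).
  apply/setP => l; rewrite imS !inE /legendre -val_eqE /=.
  have -> : (p %| l)%N = (val l == 0%N) by rewrite /dvdn modn_small.
  by case: (val l == 0%N) => //; case: [exists _, _].
have := cardsC (o |: [set s a | a : 'I_h]).
rewrite cardsU1 card_imset // !card_ord imS inE dvdn0 /=.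
by move: #|~: _|%N => c; lia.
Qed.

(** * Primitive roots modulo [p ^ 2] and discrete logarithms *)

Lemma primitive_root_mod_eq (p g : nat) : prime p -> primitive_root_mod (p ^ 2) g ->
  forall a b, (g ^ a == g ^ b %[mod p ^ 2])%N = (a == b %[mod p * p.-1])%N.
Proof.
move=> p_pr g_prim a b; have p2_gt1 : (1 < p ^ 2)%N.
  by have := prime_gt1 p_pr; nia.
have tot : totient (p ^ 2) = (p * p.-1)%N by rewrite totient_pfactor // mulnC.
rewrite -tot -(eq_prim_root_expr g_prim) -!natrX -val_eqE /=.
by rewrite !val_Zp_nat.
Qed.

Lemma primitive_root_mod_coprime (p g : nat) :
  prime p -> primitive_root_mod (p ^ 2) g -> coprime g p.
Proof.
(* Comparing the exponents [p * p.-1] and 0 shows that a positive power of [g] is 1 modulo [p ^ 2],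
   which makes [g] a unit. *)
move=> p_pr g_prim; have := primitive_root_mod_eq _ _ p_pr g_prim (p * p.-1) 0.
rewrite expn0 modnn mod0n eqxx => /eqP E.
have n_gt0 : (0 < p * p.-1)%N by have := prime_gt1 p_pr; nia.
rewrite -(coprime_pexpl _ _ n_gt0).
rewrite -coprime_modp2 E coprime_modp2.
exact: coprime1n.
Qed.

Lemma card_coprime_p2 (p : nat) : prime p ->
  #|[set i : 'I_(p ^ 2) | coprime i p]| = (p * p.-1)%N.
Proof.
move=> p_pr.
have <- : totient (p ^ 2) = (p * p.-1)%N by rewrite totient_pfactor // mulnC.
rewrite totient_count_coprime big_mkord cardsE -sum1_card big_mkcond /=.
apply: eq_bigr => i _; by rewrite coprime_sym coprime_pexpr.
Qed.

Lemma expn_coprime_bij (p g : nat) : prime p -> primitive_root_mod (p ^ 2) g ->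
  exists2 f : 'I_(p * p.-1) -> 'I_(p ^ 2),
    injective f /\ (forall e, f e \in [set i : 'I_(p ^ 2) | coprime i p])
  & forall e, f e = (g ^ e %% p ^ 2)%N :> nat.
Proof.
move=> p_pr g_prim; have p2_gt0 : (0 < p ^ 2)%N by rewrite expn_gt0 prime_gt0.
exists (fun e => Ordinal (ltn_pmod (g ^ e) p2_gt0)) => //; split.
  move=> a b /(congr1 val)/= /eqP.
  by rewrite primitive_root_mod_eq // !modn_small // => /eqP/val_inj.
move=> e; rewrite inE /= coprime_modp2 coprimeXl //.
exact: primitive_root_mod_coprime.
Qed.

(** Pigeonhole: the [p * p.-1] distinct powers of [g] fill the set of units, which has the same
    size. *)
Lemma primitive_root_mod_log (p g v : nat) : prime p ->
  primitive_root_mod (p ^ 2) g -> coprime v p ->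
  exists m, (g ^ m = v %[mod p ^ 2])%N.
Proof.
move=> p_pr g_prim cv; have p2_gt0 : (0 < p ^ 2)%N by rewrite expn_gt0 prime_gt0.
have [f [f_inj f_cop] fE] := expn_coprime_bij p g p_pr g_prim.
have : Ordinal (ltn_pmod v p2_gt0) \in [set f a | a : 'I_(p * p.-1)].
  rewrite (imset_inj_card _ _ _ _ f_inj f_cop) ?card_coprime_p2 ?card_ord //.
  by rewrite inE coprime_modp2.
by case/imsetP => e _ /(congr1 val) /=; rewrite fE => ->; exists e.
Qed.

Lemma sum_primitive_root (V : nmodType) (p g : nat) (F : nat -> V) : prime p ->
  primitive_root_mod (p ^ 2) g -> (forall a, F (a %% p ^ 2)%N = F a) ->
  \sum_(0 <= e < p * p.-1) F (g ^ e)%N = \sum_(i < p ^ 2 | coprime i p) F i.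
Proof.
move=> p_pr g_prim Fmod.
have [f [f_inj f_cop] fE] := expn_coprime_bij p g p_pr g_prim.
have := sum_inj_card _ _ _ _ _ (fun i : 'I_(p ^ 2) => F i) f_inj f_cop.
rewrite card_coprime_p2 // card_ord => /(_ (leqnn _)) S.
rewrite big_mkord; transitivity (\sum_a F (f a)).
  by apply: eq_bigr => e _; rewrite fE Fmod.
by rewrite S; apply: eq_bigl => i; rewrite inE.
Qed.

(** * Ramanujan sums in characteristic 2 *)

Lemma natr_pchar2 (R : nzRingType) (n : nat) : 2 \in [pchar R] ->
  n%:R = (odd n)%:R :> R.
Proof.
move=> char2; rewrite -[in LHS](odd_double_half n) natrD -mul2n natrM.
by rewrite (pcharf0 char2) mul0r addr0.
Qed.

(** In characteristic 0 the value is p^2 [p^2 | m] - p [p | m], the sum over all residues minus that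
    over the multiples of p; as p is odd, both coefficients become 1 in characteristic 2. *)
Lemma ramanujan_sum_p2 (L : fieldType) (p : nat) (beta : L) (m : nat) :
  2 \in [pchar L] -> prime p -> odd p -> (p ^ 2)%N.-primitive_root beta ->
  \sum_(i < p ^ 2 | coprime i p) beta ^+ (i * m) =
  (p ^ 2 %| m)%:R + (p %| m)%:R.
Proof.
move=> char2 p_pr p_odd beta_prim; have p_gt0 := prime_gt0 p_pr.
have beta_eq1 k : (beta ^+ k == 1) = (p ^ 2 %| k)%N.
  by rewrite -(prim_order_dvd beta_prim).
have all_sum : \sum_(i < p ^ 2) beta ^+ (i * m) = (p ^ 2 %| m)%:R.
  rewrite (eq_bigr (fun i : 'I_(p ^ 2) => (beta ^+ m) ^+ i)) => [|i _]; last first.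
    by rewrite mulnC exprM.
  rewrite sum_geometric_root ?beta_eq1; last first.
    by rewrite exprAC (prim_expr_order beta_prim) expr1n.
  by rewrite natr_pchar2 // oddX p_odd mul1r.
have f_lt (a : 'I_p) : (p * a < p ^ 2)%N by rewrite ltn_pmul2l.
have h_lt (w : 'I_(p ^ 2)) : (w %/ p < p)%N by rewrite ltn_divLR.
have mult_sum : \sum_(i < p ^ 2 | ~~ coprime i p) beta ^+ (i * m) = (p %| m)%:R.
  rewrite (reindex_onto (fun a => Ordinal (f_lt a)) (fun w => Ordinal (h_lt w))).
    rewrite (eq_big (fun=> true) (fun a : 'I_p => (beta ^+ (p * m)) ^+ a)).
    - rewrite sum_geometric_root; last first.
        by rewrite -exprM mulnAC mulnn exprM (prim_expr_order beta_prim) expr1n.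
      rewrite beta_eq1 -[(p ^ 2)%N]/(p * p)%N dvdn_pmul2l //.
      by rewrite natr_pchar2 // p_odd mul1r.
    - move=> a; rewrite -val_eqE /= mulKn // eqxx andbT.
      by rewrite coprime_sym prime_coprime // dvdn_mulr.
    - by move=> a _; rewrite /= mulnAC exprM.
  move=> w; rewrite coprime_sym prime_coprime // negbK => p_w.
  by apply: val_inj; rewrite /= mulnC divnK.
rewrite -all_sum -mult_sum.
rewrite [X in _ = X + _](bigID (fun i : 'I_(p ^ 2) => coprime i p)) /=.
by rewrite addrK_pchar2.
Qed.

(** * Symmetries of the sequence and its discrete Fourier transform *)

Lemma legendre_fermatE (p u : nat) : prime p ->
  legendre_fermat p u = (legendre p (fermat_quotient p u) == -1)%:R.
Proof.
move=> p_pr; rewrite /legendre_fermat /legendre.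
have := fermat_quotient_lt p u p_pr; set a := fermat_quotient p u => a_lt.
have -> : (p %| a)%N = (a == 0%N) by rewrite /dvdn modn_small.
by case: (a == 0%N) => //; case: [exists _, _].
Qed.

Lemma legendre_fermat_mod (p u : nat) : prime p ->
  legendre_fermat p (u %% p ^ 2) = legendre_fermat p u.
Proof. by move=> p_pr; rewrite /legendre_fermat fermat_quotient_mod. Qed.

Lemma legendre_fermat_noncoprime (p u : nat) :
  ~~ coprime u p -> legendre_fermat p u = 0.
Proof.
by move=> /negPf nc; rewrite /legendre_fermat /fermat_quotient nc orbT.
Qed.

(** The factor [p ^ 2 - 1] plays the role of -1. As p - 1 is even, u and -u have the same power of
    exponent p - 1, hence the same quotient. This evenness absorbs a sign in the Fourier
    inversion. *)
Lemma legendre_fermatN (p u : nat) : prime p -> odd p ->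
  legendre_fermat p ((p ^ 2 - 1) * u) = legendre_fermat p u.
Proof.
move=> p_pr p_odd; have p_gt1 := prime_gt1 p_pr.
have cN : coprime (p ^ 2 - 1) p.
  by rewrite -(@coprime_pexpr 2) // subn1 coprimePn // expn_gt0 ltnW.
have [cu | nu] := boolP (coprime u p); last first.
  by rewrite !legendre_fermat_noncoprime // coprimeMl cN.
suff E : fermat_quotient p ((p ^ 2 - 1) * u) = fermat_quotient p u.
  by rewrite /legendre_fermat E.
apply/eqP; rewrite fermat_quotient_eq // ?coprimeMl ?cN // expnMn -modnMml.
have -> : ((p ^ 2 - 1) ^ p.-1 = 1 %[mod p ^ 2])%N; last by rewrite modnMml mul1n.
have [h ->] : exists h, p.-1 = (2 * h)%N by exists p./2; lia.
rewrite expnM -modnXm.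
have -> : ((p ^ 2 - 1) ^ 2 = (p ^ 2 - 2) * p ^ 2 + 1)%N.
  have : (4 <= p ^ 2)%N by nia.
  by move: (p ^ 2)%N => q; nia.
by rewrite modnMDl modnXm exp1n.
Qed.

Lemma fermat_quotientX (p u e : nat) : prime p -> coprime u p ->
  fermat_quotient p (u ^ e) = ((e * fermat_quotient p u) %% p)%N.
Proof.
move=> p_pr cu; elim: e => [|e IHe].
  by rewrite /fermat_quotient coprime1n exp1n subnn div0n.
by rewrite expnS fermat_quotientM ?coprimeXl // IHe modnDmr mulSn.
Qed.

(* The discrete Fourier transform of the sequence at a unit [x = g ^ e]: the
   substitution [v = x * w] turns [D_l(beta ^ x)] into [D_(l + q_p(x))(beta)]. *)
Lemma eta'E (L : fieldType) (iota : {rmorphism 'F_2 -> L}) (beta : L)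
    (p g k j : nat) : prime p -> (p ^ 2)%N.-primitive_root beta -> coprime g p ->
  eta' iota beta p (fermat_quotient p g) j =
  \sum_(w < p ^ 2) iota (legendre_fermat p w) * beta ^+ (g ^ (k * p + j) * w).
Proof.
move=> p_pr beta_prim cg; set delta := fermat_quotient p g.
set x := (g ^ (k * p + j))%N; have cx : coprime x p by rewrite coprimeXl.
(* The part [k * p] of the exponent contributes a multiple of p to the quotient, so the transform at
   [x] depends on [j] only. *)
have fqx : fermat_quotient p x = ((j * delta) %% p)%N.
  by rewrite fermat_quotientX // mulnDl mulnAC modnMDl.
pose S v := \sum_(l in nonresidues p |
  coprime v p && (fermat_quotient p v == (l + j * delta) %% p)%N) beta ^+ v.
transitivity (\sum_(v < p ^ 2) S v).
  rewrite [RHS](exchange_big_dep (mem (nonresidues p))) /=; last first.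
    by move=> ? ? _ /andP[].
  apply: eq_bigr => l Nl; rewrite /fq_class_poly rmorph_sum horner_sum /=.
  apply: eq_big => [v | v _]; first by rewrite inE Nl.
  by rewrite map_polyXn hornerXn.
rewrite -(sum_reindex_mod _ _ S (fun w => x * w)%N).
- apply: eq_bigr => w _; rewrite /S coprimeMl cx /=.
  have [cw | nw] := boolP (coprime w p); last first.
    rewrite legendre_fermat_noncoprime // rmorph0 mul0r.
    by rewrite big_pred0 // => l; rewrite andbF.
  have w_lt := fermat_quotient_lt p w p_pr.
  (* Only l = q_p(w) can contribute at the exponent x w, and it does so exactly when q_p(w) is a
     non-residue. *)
  have E (l : 'I_p) : (fermat_quotient p (x * w) == (l + j * delta) %% p)%N =
      (l == Ordinal w_lt).
    rewrite fermat_quotientM // fqx modnDml addnC eqn_modDr !modn_small //.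
    by rewrite eq_sym.
  rewrite legendre_fermatE // rmorph_nat; case: eqP => [Nw | nNw].
    rewrite mul1r (big_pred1 (Ordinal w_lt)) // => l; rewrite E /= inE.
    by have [-> | _] := eqVneq l (Ordinal w_lt); rewrite ?andbF // /= Nw.
  rewrite mul0r big_pred0 // => l; rewrite E /= inE.
  by have [-> | _] := eqVneq l (Ordinal w_lt); rewrite ?andbF // andbT; apply/eqP.
- by rewrite expn_gt0 prime_gt0.
- move=> a; apply: eq_big => [l|l _]; last by rewrite (prim_expr_mod beta_prim).
  by rewrite coprime_modp2 fermat_quotient_mod.
- by move=> a b; apply: mulnI_mod; rewrite coprime_sym coprimeXr.
Qed.

(** The factor [q - 1] stands for -1 modulo every divisor of [q], so the sum represents [u - w]. *)
Lemma dvdn_negD (q d w u : nat) : (0 < q)%N -> (d %| q)%N ->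
  (d %| (q - 1) * w + u)%N = (w == u %[mod d])%N.
Proof.
move=> q_gt0 /dvdnP[c q_cd].
have <- : (w + ((q - 1) * w + u) == w + 0 %[mod d])%N = (d %| (q - 1) * w + u)%N.
  by rewrite eqn_modDl mod0n.
have -> : (w + ((q - 1) * w + u) = q * w + u)%N by nia.
by rewrite addn0 q_cd mulnAC modnMDl eq_sym.
Qed.

Lemma sum_mulr_eq (R : pzRingType) (I : finType) (P : pred I) (F : I -> R) :
  \sum_i F i * (P i)%:R = \sum_(i | P i) F i.
Proof.
rewrite [RHS]big_mkcond; apply: eq_bigr => i _.
by case: (P i); rewrite ?mulr1 ?mulr0.
Qed.

Lemma sum_nat_muln (V : nmodType) (p n : nat) (F : nat -> V) :
  \sum_(0 <= e < p * n) F e = \sum_(0 <= j < p) \sum_(0 <= k < n) F (k * p + j)%N.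
Proof.
rewrite mulnC big_nat_mul exchange_big /=; apply: eq_bigr => k _.
rewrite -{1}[(k * p)%N]add0n big_addn mulSn addnK.
by apply: eq_bigr => j _; rewrite addnC.
Qed.

(** Fourier inversion restricted to the frequencies prime to p. Of the two terms of the Ramanujan
    sum, divisibility by p^2 isolates f_u, and divisibility by p leaves the sum of the sequence over
    the class of u modulo p. *)
Lemma sum_eta' (L : fieldType) (iota : {rmorphism 'F_2 -> L}) (beta : L)
    (p g u : nat) : prime p -> odd p -> primitive_root_mod (p ^ 2) g ->
  (p ^ 2)%N.-primitive_root beta ->
  \sum_(0 <= j < p) eta' iota beta p (fermat_quotient p g) j
    * (\sum_(0 <= k < p.-1) beta ^+ (u * g ^ (k * p + j))) =
  iota (legendre_fermat p u) +
  \sum_(w < p ^ 2 | w == u %[mod p]) iota (legendre_fermat p w).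
Proof.
move=> p_pr p_odd g_prim beta_prim.
have p2_gt0 : (0 < p ^ 2)%N by rewrite expn_gt0 prime_gt0.
have cg := primitive_root_mod_coprime p g p_pr g_prim.
have char2 : 2 \in [pchar L] by apply: (rmorph_pchar iota); rewrite pchar_Fp.
pose f w := iota (legendre_fermat p w).
(* The transform and its inverse carry the same sign here, so the Ramanujan sum first detects the
   index -u. *)
pose F x := \sum_(w < p ^ 2) f w * beta ^+ (x * (w + u)).
transitivity (\sum_(0 <= e < p * p.-1) F (g ^ e)%N).
  rewrite sum_nat_muln; apply: eq_bigr => j _; rewrite mulr_sumr.
  apply: eq_bigr => k _; rewrite (eta'E _ _ _ _ _ k) // mulr_suml.
  apply: eq_bigr => w _; rewrite -mulrA -exprD mulnDr.
  by rewrite [(g ^ _ * u)%N]mulnC.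
rewrite sum_primitive_root //; last first.
  move=> x; apply: eq_bigr => w _; congr (_ * _).
  by apply/eqP; rewrite (eq_prim_root_expr beta_prim) modnMml.
rewrite exchange_big /=.
under eq_bigr => w _ do rewrite -mulr_sumr ramanujan_sum_p2 // mulrDr.
pose h w := f w * (p ^ 2 %| w + u)%N%:R + f w * (p %| w + u)%N%:R.
(* Replacing w by -w turns [w + u] into [u - w], and [f] is even. *)
rewrite -/(h _) -(sum_reindex_mod _ _ h (fun w => (p ^ 2 - 1) * w)%N) //;
  last 2 first.
- move=> w; rewrite /h /f legendre_fermat_mod //.
  have E d : (d %| p ^ 2)%N -> (d %| w %% p ^ 2 + u)%N = (d %| w + u)%N.
    by move=> d_p; rewrite /dvdn -modnDml modn_dvdm // modnDml.
  by rewrite !E // dvdn_exp.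
- by move=> a b; apply: mulnI_mod; rewrite coprime_sym subn1 coprimePn.
rewrite (eq_bigr (fun w : 'I_(p ^ 2) => f w * (w == u %[mod p ^ 2])%N%:R
    + f w * (w == u %[mod p])%N%:R)) => [|w _]; last first.
  rewrite /h /f legendre_fermatN // (dvdn_negD _ (p ^ 2)) //.
  by rewrite (dvdn_negD _ p) // dvdn_exp.
rewrite big_split /= !sum_mulr_eq; congr (_ + _).
rewrite -(legendre_fermat_mod p u) // (big_pred1 (Ordinal (ltn_pmod u p2_gt0))) //.
by move=> w; rewrite /= -val_eqE /= (modn_small (ltn_ord w)).
Qed.

(** The sequence vanishes on multiples of p. On a class of units the quotient takes each value once,
    so the sum counts the non-residues. *)
Lemma sum_legendre_fermat_class (p u : nat) : prime p -> odd p ->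
  \sum_(w < p ^ 2 | w == u %[mod p]) legendre_fermat p w =
  ((p - 1) %/ 2)%:R * (~~ (p %| u)%N)%:R.
Proof.
move=> p_pr p_odd; rewrite -prime_coprime // coprime_sym.
have [cu | nu] := boolP (coprime u p); last first.
  rewrite mulr0 big1 // => w /eqP E; rewrite legendre_fermat_noncoprime //.
  by rewrite -coprime_modl E coprime_modl.
under eq_bigr => w _ do rewrite legendre_fermatE //.
rewrite (sum_fermat_quotient _ p u (fun l => (legendre p l == -1)%:R)) //.
rewrite mulr1 -card_nonresidues // -natr_sum -sum1_card.
congr _%:R; rewrite [RHS]big_mkcond; apply: eq_bigr => l _; rewrite inE.
by case: eqP.
Qed.

(** * Powers of [g] and of 2 modulo [p] *)

Lemma sum_expr_mulp_primitive_root (L : fieldType) (p g : nat) (beta : L) (u : nat) :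
  2 \in [pchar L] -> prime p -> odd p -> primitive_root_mod (p ^ 2) g ->
  (p ^ 2)%N.-primitive_root beta ->
  \sum_(0 <= k < p.-1) beta ^+ (u * p * g ^ k) = (~~ (p %| u)%N)%:R.
Proof.
move=> char2 p_pr p_odd g_prim beta_prim; have p_gt0 := prime_gt0 p_pr.
have beta_mod a b : (a = b %[mod p ^ 2])%N -> beta ^+ a = beta ^+ b.
  by move=> E; apply/eqP; rewrite (eq_prim_root_expr beta_prim) E.
have cg := primitive_root_mod_coprime p g p_pr g_prim.
have := ramanujan_sum_p2 L p beta (u * p) char2 p_pr p_odd beta_prim.
rewrite -(sum_primitive_root _ p g (fun i => beta ^+ (i * (u * p)))) //; last first.
  by move=> a; apply: beta_mod; rewrite modnMml.
(* The powers of [g] split into [p] blocks with equal sums, as [beta ^+ (u * p * x)] depends only on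
   [x] modulo [p]; since [p] is odd, the [p] copies amount to one in characteristic 2. *)
rewrite big_nat_mul (eq_bigr (fun=> \sum_(0 <= k < p.-1) beta ^+ (u * p * g ^ k))).
  rewrite sumr_const_nat subn0 -[_ *+ p]mulr_natl natr_pchar2 // p_odd mul1r => ->.
  rewrite -[(p ^ 2)%N]/(p * p)%N dvdn_pmul2r // dvdn_mull //.
  by case: (p %| u)%N; rewrite ?add0r ?addrr_pchar2.
move=> i _; rewrite -{1}[(i * p.-1)%N]add0n big_addn mulSn addnK.
apply: eq_bigr => k _; apply: beta_mod.
have -> : (g ^ (k + i * p.-1) * (u * p) = p * (u * (g ^ k * (g ^ p.-1) ^ i)))%N.
  by rewrite expnD [(i * _)%N]mulnC expnM; nia.
rewrite mulnAC [(_ * p)%N]mulnC -[(p ^ 2)%N]/(p * p)%N -!muln_modr.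
congr (p * _)%N; rewrite mulnA -modnMmr -modnXm fermat_little // modnXm exp1n.
by rewrite modnMmr muln1.
Qed.

(** Raising g^a = 1 modulo p to the power p lifts it to g^(a p) = 1 modulo p^2, where the order p (p
    - 1) of g applies. *)
Lemma modn_pred_primitive_root (p g a : nat) : prime p ->
  primitive_root_mod (p ^ 2) g -> (g ^ a == 1 %[mod p])%N = (p.-1 %| a)%N.
Proof.
move=> p_pr g_prim; have p_gt0 := prime_gt0 p_pr.
have cg := primitive_root_mod_coprime p g p_pr g_prim.
apply/eqP/dvdnP => [/expn_p_mod /eqP | [k ->]]; last first.
  by rewrite mulnC expnM -modnXm fermat_little // modnXm exp1n.
rewrite exp1n -expnM -(expn0 g) primitive_root_mod_eq // mod0n mulnC.
by rewrite -/(dvdn _ _) dvdn_pmul2l // => /dvdnP.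
Qed.

Lemma order_two_dvdn (p lambda i : nat) : (0 < lambda)%N ->
  (2 ^ lambda = 1 %[mod p])%N ->
  (forall m, 0 < m -> 2 ^ m = 1 %[mod p] -> lambda <= m)%N ->
  (2 ^ i == 1 %[mod p])%N = (lambda %| i)%N.
Proof.
move=> l_gt0 l_ord l_min.
have E : (2 ^ i = 2 ^ (i %% lambda) %[mod p])%N.
  rewrite [in LHS](divn_eq i lambda) mulnC expnD expnM -modnMml -modnXm l_ord.
  by rewrite modnXm exp1n modnMml mul1n.
apply/eqP/idP => [i1 | /eqP i0]; last by rewrite E i0.
rewrite /dvdn; case: posnP => // r_gt0.
have := l_min _ r_gt0; rewrite -E i1 => /(_ erefl).
by rewrite leqNgt ltn_mod l_gt0.
Qed.

(** * Traces as sums over cosets of the powers of 2 *)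

Theorem theorem2
    (* (L, iota) is an algebraic closure of 'F_2 *)
    (L : closedFieldType) (iota : {rmorphism 'F_2 -> L})
    (L_algebraic : integralRange iota)
    (p : nat) (p_prime : prime p) (p_odd : odd p)
    (g : nat) (g_primitive : primitive_root_mod (p ^ 2) g)
    (delta : nat) (delta_def : fermat_quotient p g = delta)
    (beta : L) (beta_primitive : (p ^ 2)%N.-primitive_root beta)
    (lambda : nat) (lambda_gt0 : (0 < lambda)%N)
    (lambda_order : (2 ^ lambda = 1 %[mod p])%N)
    (lambda_min : forall m : nat,
       (0 < m)%N -> (2 ^ m = 1 %[mod p])%N -> (lambda <= m)%N) :
  ((2 ^ p.-1 <> 1 %[mod p ^ 2])%N ->
   forall u : nat,
     iota (legendre_fermat p u) =
       ((p - 1) %/ 2)%:R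
         * (\sum_(0 <= k < (p - 1) %/ lambda)
              trace2 lambda 1 (beta ^+ (u * p * g ^ k)))
       + \sum_(0 <= j < p) eta' iota beta p delta j
           * (\sum_(0 <= k < (p - 1) %/ lambda)
                trace2 (lambda * p) p (beta ^+ (u * g ^ (k * p + j)))))
  /\
  ((2 ^ p.-1 = 1 %[mod p ^ 2])%N ->
   forall u : nat,
     iota (legendre_fermat p u) =
       ((p - 1) %/ 2)%:R
         * (\sum_(0 <= k < (p - 1) %/ lambda)
              trace2 lambda 1 (beta ^+ (u * p * g ^ k)))
       + \sum_(0 <= j < p) eta' iota beta p delta j
           * (\sum_(0 <= k < (p - 1) %/ lambda)
                trace2 lambda 1 (beta ^+ (u * g ^ (k * p + j))))).
Proof.
have p_gt1 := prime_gt1 p_prime; have p_gt0 := ltnW p_gt1.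
have n_gt0 : (0 < p.-1)%N by rewrite -subn1 subn_gt0.
have beta_mod a b : (a = b %[mod p ^ 2])%N -> beta ^+ a = beta ^+ b.
  by move=> E; apply/eqP; rewrite (eq_prim_root_expr beta_primitive) E.
have char2 : 2 \in [pchar L] by apply: (rmorph_pchar iota); rewrite pchar_Fp.
have cop2 : coprime 2 p by rewrite coprime2n.
have cop_pn : coprime p.-1 p by rewrite coprimePn.
have l_dvd : (lambda %| p.-1)%N.
  by rewrite -(order_two_dvdn p) //; apply/eqP/fermat_little.
have n_ql : p.-1 = (p.-1 %/ lambda * lambda)%N by rewrite divnK.
(* [m] is the discrete logarithm of 2: raising [beta ^+ (c * g ^ a)] to the power [2 ^ i] shifts [a]
   by [m * i]. *)
have [m gm2] := primitive_root_mod_log _ _ _ p_prime g_primitive cop2.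
have g_mod_n a b : (a = b %[mod p.-1])%N -> (g ^ a = g ^ b %[mod p])%N.
  move=> E; rewrite (divn_eq a p.-1) (divn_eq b p.-1) E !expnD ![(_ * p.-1)%N]mulnC.
  have cg := primitive_root_mod_coprime _ _ p_prime g_primitive.
  rewrite !expnM -!(modnMml (_ ^ _)) -!(modnXm _ _ (g ^ _)).
  by rewrite fermat_little // !modnXm !exp1n.
(* In Z/(p - 1) the order of [m] is [lambda], the order of 2 = g^m modulo p. *)
have m_ord i : (p.-1 %| m * i)%N = (lambda %| i)%N.
  rewrite -(modn_pred_primitive_root p g) // -(order_two_dvdn p) // expnM.
  have gm2p : (g ^ m = 2 %[mod p])%N.
    by rewrite -[LHS](@modn_dvdm (p ^ 2)) ?dvdn_exp // gm2 modn_dvdm ?dvdn_exp.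
  by rewrite -[X in X == _]modnXm gm2p modnXm.
have m_l : (p.-1 %| m * lambda)%N by rewrite m_ord.
have g_pow a i : (g ^ a * 2 ^ i = g ^ (a + m * i) %[mod p ^ 2])%N.
  by rewrite expnD expnM -modnMmr -modnXm -gm2 modnXm modnMmr.
(* Only [a] modulo [p.-1] matters, as g^p has order p - 1 modulo p^2. *)
have G_mod u j a :
    beta ^+ (u * g ^ (a %% p.-1 * p + j)) = beta ^+ (u * g ^ (a * p + j)).
  apply: beta_mod; rewrite -modnMmr -[in RHS]modnMmr; congr ((_ * _) %% _)%N.
  apply/eqP; rewrite primitive_root_mod_eq // eqn_modDr ![(_ * p)%N]mulnC.
  by rewrite muln_modr modn_mod.
have trace1 x : trace2 lambda 1 x = \sum_(i < lambda) x ^+ (2 ^ i).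
  by rewrite /trace2 divn1; apply: eq_bigr => i _; rewrite muln1.
(* The k-th trace runs over the exponents k + m i, a coset of the subgroup of Z/(p - 1) generated by
   m; the factor [p] makes exponents of [g] count modulo p - 1. *)
have first_sum u : \sum_(0 <= k < (p - 1) %/ lambda)
    trace2 lambda 1 (beta ^+ (u * p * g ^ k)) = (~~ (p %| u)%N)%:R.
  rewrite subn1 -(sum_expr_mulp_primitive_root _ p g beta u) //.
  rewrite -(sum_subgroup_cosets _ _ (p.-1 %/ lambda) lambda m
    (fun e => beta ^+ (u * p * g ^ e))) //; last first.
  - by move=> i; rewrite m_ord.
  - move=> a; apply: beta_mod; rewrite -![(u * p * _)%N]mulnA ![(u * (p * _))%N]mulnCA.
    rewrite -[(p ^ 2)%N]/(p * p)%N -!muln_modr; congr (p * _)%N.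
    by rewrite -modnMmr (g_mod_n _ a) ?modn_mod // modnMmr.
  apply: eq_bigr => k _; rewrite trace1; apply: eq_bigr => i _.
  rewrite -exprM -mulnA; apply: beta_mod.
  by rewrite -modnMmr g_pow modnMmr.
(* The sum over the class of u modulo p occurs twice and cancels in characteristic 2. *)
have combine u : iota (legendre_fermat p u) =
    ((p - 1) %/ 2)%:R * (~~ (p %| u)%N)%:R
    + \sum_(0 <= j < p) eta' iota beta p delta j
           * (\sum_(0 <= k < p.-1) beta ^+ (u * g ^ (k * p + j))).
  rewrite -delta_def sum_eta' // -rmorph_sum sum_legendre_fermat_class //.
  by rewrite rmorphM !rmorph_nat addrC addrK_pchar2.
split=> H u; rewrite first_sum combine; congr (_ + _);
  apply: eq_bigr => j _; congr (_ * _); rewrite subn1.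
  (* The i-th term of this trace is a power of exponent 2^(i p), which shifts the exponent of [g] by
     m i p, hence [k] by m i. *)
  rewrite -(sum_subgroup_cosets _ _ (p.-1 %/ lambda) lambda m
    (fun e => beta ^+ (u * g ^ (e * p + j)))) //; last first.
  - by move=> i; rewrite m_ord.
  apply: eq_bigr => k _; rewrite /trace2 mulnK //; apply: eq_bigr => i _.
  rewrite -exprM -mulnA; apply: beta_mod.
  rewrite -[RHS]modnMmr g_pow modnMmr; congr ((_ * g ^ _) %% _)%N; lia.
(* From g^(m (p - 1)) = 2^(p - 1) = 1 modulo p^2 it follows that p divides m, so 2 is the p-th power
   of g^m'. Squaring then shifts [k] by [m']. *)
have [m' m_p] : exists m', m = (m' * p)%N.
  apply/dvdnP; have /eqP : (g ^ (m * p.-1) = g ^ 0 %[mod p ^ 2])%N.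
    by rewrite expnM -modnXm gm2 modnXm H expn0.
  by rewrite primitive_root_mod_eq // mod0n -/(dvdn _ _) dvdn_pmul2r.
(* [m'] has the same order as [m] in Z/(p - 1), since p is prime to p - 1. *)
have m'_ord i : (p.-1 %| m' * i)%N = (lambda %| i)%N.
  by rewrite -m_ord m_p mulnAC [RHS]Gauss_dvdl.
rewrite -(sum_subgroup_cosets _ _ (p.-1 %/ lambda) lambda m'
  (fun e => beta ^+ (u * g ^ (e * p + j)))) //; last first.
- by move=> i; rewrite m'_ord.
- by rewrite m'_ord.
apply: eq_bigr => k _; rewrite trace1; apply: eq_bigr => i _.
rewrite -exprM -mulnA; apply: beta_mod.
rewrite -[RHS]modnMmr g_pow modnMmr m_p; congr ((_ * g ^ _) %% _)%N; lia.
Qed.
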